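(* Assume that $N+1>J$. Then for all $x\in\Omega$, $$\boldsymbol{\phi}_x\in\mathrm{Range}(\mathbf{F}\mathbf{F}^* )\quad\text{if and only if}\quad x\in\{x_j:j=1,\dots,J\}.$$
   Context: $\Omega$ is the open unit ball (disk) in $\mathbb{R}^2$ (so $d=2$), $x_1,\dots,x_J\in\Omega$ are pairwise distinct points, $N$ is a nonnegative integer and $\epsilon>0$. The region $D=\bigcup_{j=1}^J D_j\subset\Omega$ consists of disjoint sets $D_j=x_j+\epsilon B_j$, with $B_j$ a domain with $\mathcal{C}^2$ boundary centered at the origin; $|\partial B_j|$ is the length of $\partial B_j$. The function $\gamma\in L^\infty(\partial D)$ satisfies $0<\gamma_{\min}\le\gamma\le\gamma_{\max}$ a.e. on $\partial D$, and $\mathrm{Avg}(\gamma_j)$ is the average value of $\gamma$ on $\partial D_j$. For $n=0,\dots,N$, $f_n=e^{in\theta}$ on $\partial\Omega$ ($\theta$ the polar angle), and $u_0(\cdot,f_n)$ is the harmonic function in $\Omega$ with boundary value $f_n$, i.e. $u_0(x,f_n)=|x|^ne^{in\theta}$ where $\theta$ is the polar angle of $x$. The matrix $\mathbf{F}\in\mathbb{C}^{(N+1)\times(N+1)}$ has entries $$\mathbf{F}_{n,m}=\epsilon^{d-1}\sum_{j=1}^J|\partial B_j|\,\mathrm{Avg}(\gamma_j)\,u_0(x_j,f_m)\,u_0(x_j,f_n),\qquad n,m=0,\dots,N,$$ and $\mathbf{F}^*$ is its conjugate transpose. For $x\in\Omega$, $\boldsymbol{\phi}_x=\big(u_0(x,f_0),\dots,u_0(x,f_N)\big)^\top\in\mathbb{C}^{N+1}$.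 *)

(* Defs.v *)
From HB Require Import structures.
From mathcomp Require Import all_boot all_order all_algebra.
From mathcomp Require Import complex.
From mathcomp Require Import all_classical all_reals all_analysis.
Set Implicit Arguments.
Unset Strict Implicit.
Unset Printing Implicit Defensive.
Import Order.TTheory GRing.Theory Num.Theory.
Import numFieldNormedType.Exports.
Local Open Scope classical_set_scope.
Local Open Scope ring_scope.
Local Open Scope complex_scope.

Section plane.
Context {R : realType}.
Implicit Types (p q : R * R) (A B : set (R * R)).

(* The library norm on [R * R] is the max norm (with the same topology). *)
Definition enorm p : R := Num.sqrt (p.1 ^+ 2 + p.2 ^+ 2).

Definition unit_disk : set (R * R) := [set p | enorm p < 1].

Definition closed_unit_disk : set (R * R) := [set p | enorm p <= 1].

Definition frontier A : set (R * R) := closure A `\` interior A.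

(* 0 is included so that the empty set has diameter 0 rather than -oo *)
Definition diam A : \bar R :=
  ereal_sup (0%E |` [set (enorm (pq.1 - pq.2))%:E | pq in A `*` A]).

Definition diam_cover (delta : R) A : set ((set (R * R))^nat) :=
  [set U | (forall i, (diam (U i) <= delta%:E)%E) /\ A `<=` \bigcup_i U i].

Definition hausdorff1_pre (delta : R) A : \bar R :=
  ereal_inf [set (\sum_(i <oo) diam (U i))%E | U in diam_cover delta A].

(* One-dimensional Hausdorff outer measure.  Its normalisation constant is 1,
   so that it is the arc length on rectifiable simple curves. *)
Definition hausdorff1 A : \bar R :=
  ereal_sup [set hausdorff1_pre delta A | delta in [set delta : R | 0 < delta]].

Lemma diam_ge0 A : (0 <= diam A)%E.
Proof. by apply: ereal_sup_ubound; left. Qed.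

Lemma diam0 : diam set0 = 0%E.
Proof.
apply/eqP; rewrite eq_le diam_ge0 andbT.
by apply: ge_ereal_sup => _ [->//|[pq [[]]]].
Qed.

Lemma hausdorff1_pre_ge0 delta A : (0 <= hausdorff1_pre delta A)%E.
Proof.
apply: le_ereal_inf_tmp => _ [U _ <-].
by apply: nneseries_ge0 => *; exact: diam_ge0.
Qed.

Lemma hausdorff1_pre0 delta : 0 < delta -> hausdorff1_pre delta set0 = 0%E.
Proof.
move=> d0; apply/eqP; rewrite eq_le hausdorff1_pre_ge0 andbT.
apply: ereal_inf_lbound; exists (fun=> set0).
  by split=> // i; rewrite diam0 lee_fin ltW.
by apply: eseries0 => *; exact: diam0.
Qed.

Lemma le_hausdorff1_pre delta :
  {homo hausdorff1_pre delta : A B / A `<=` B >-> (A <= B)%E}.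
Proof.
move=> A B AB; apply/ereal_inf_le_tmp => _ [U [dU BU] <-].
by exists U => //; split => //; exact: subset_trans BU.
Qed.

Lemma hausdorff1_pre_sigma_subadditive delta :
  sigma_subadditive (hausdorff1_pre delta).
Proof.
move=> A; have [[i ioo]|] := pselect (exists i, hausdorff1_pre delta (A i) = +oo%E).
  rewrite (eseries_pinfty _ _ ioo) ?leey// => n _.
  by rewrite -ltNye (lt_le_trans _ (hausdorff1_pre_ge0 _ _)).
rewrite -forallNE => Aoo.
suff add2e (e : {posnum R}) : (hausdorff1_pre delta (\bigcup_n A n) <=
    \sum_(i <oo) hausdorff1_pre delta (A i) + e%:num%:E)%E.
  by apply/lee_addgt0Pr => _/posnumP[].
rewrite (le_trans _ (epsilon_trick _ _ _))//; last first.
  by move=> n; exact: hausdorff1_pre_ge0.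
pose P n (B : (set (R * R))^nat) := diam_cover delta (A n) B /\
  (\sum_(k <oo) diam (B k) <=
   hausdorff1_pre delta (A n) + (e%:num / (2 ^ n.+1)%:R)%:E)%E.
have [G PG] : {G : ((set (R * R))^nat)^nat & forall n, P n (G n)}.
  apply: (@choice _ _ P) => n; rewrite /P /hausdorff1_pre.
  set S := (X in ereal_inf X); move infS : (ereal_inf S) => iS.
  case: iS infS => [r Sr|Soo|Soo].
  - have en1 : (0 < e%:num / (2 ^ n.+1)%:R)%R by [].
    have /(lb_ereal_inf_adherent en1) : ereal_inf S \is a fin_num by rewrite Sr.
    move=> [x [B AnB muBx] xS].
    by exists B; split => //; rewrite muBx -Sr; exact/ltW.
  - by have := Aoo n; rewrite /hausdorff1_pre Soo.
  - suff : lbound S 0%E by move/le_ereal_inf_tmp; rewrite Soo.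
    by move=> /= _ [B _ <-]; apply: nneseries_ge0 => *; exact: diam_ge0.
have muG_ge0 x : (0 <= (diam \o uncurry G) x)%E by exact: diam_ge0.
apply: (@le_trans _ _ (\esum_(i in setT) (diam \o uncurry G) i)%E).
  apply: ereal_inf_lbound => /=.
  have /card_esym/ppcard_eqP[f] := card_nat2.
  exists (uncurry G \o f).
    split => [i|]; first by rewrite /=; case: (f i) => a b; exact: (PG a).1.1.
    apply: (@subset_trans _ (\bigcup_n \bigcup_k G n k)) => [t [i _]|].
      by move=> /(PG i).1.2 -[j _ ?]; exists i => //; exists j.
    move=> t [i _ [j _ Bijt]]; exists (f^-1%FUN (i, j)) => //=.
    by rewrite invK ?inE.
  rewrite -(esum_pred_image (diam \o uncurry G) _ xpredT) ?[fun=> _]set_true//.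
  by rewrite image_eq.
rewrite (_ : esum _ _ = \sum_(i <oo) \sum_(j <oo ) diam (G i j))%E; last first.
  pose J : nat -> set (nat * nat) := fun i => [set (i, j) | j in setT].
  rewrite (_ : setT = \bigcup_k J k); last first.
    by rewrite predeqE => -[a b]; split => // _; exists a => //; exists b.
  rewrite esum_bigcupT /=; last 2 first.
    - apply/trivIsetP => i j _ _ ij.
      rewrite predeqE => -[n m] /=; split => //= -[] [_] _ [<-{n} _].
      by move=> [m' _] [] /esym/eqP; rewrite (negbTE ij).
    - by move=> /= [n m]; exact: diam_ge0.
  rewrite -(image_id [set: nat]) -fun_true esum_pred_image//; last first.
    by move=> n _; apply: esum_ge0 => *; exact: muG_ge0.
  apply: eq_eseriesr => /= j _.
  rewrite -(esum_pred_image (diam \o uncurry G) (pair j) predT)//=; last first.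
    by move=> ? ? _ _; exact: (@can_inj _ _ _ snd).
    by move=> n _; exact: diam_ge0.
  by congr esum; rewrite predeqE => -[a b]; split; move=> [i _ <-]; exists i.
apply: lee_lim.
- apply: is_cvg_nneseries => n *.
  by apply: nneseries_ge0 => m *; exact: (muG_ge0 (n, m)).
- by apply: is_cvg_nneseries => n *; apply: adde_ge0 => //; exact: hausdorff1_pre_ge0.
- by near=> n; apply: lee_sum => i _; exact: (PG i).2.
Unshelve. all: by end_near. Qed.

Lemma hausdorff1_pre_le delta A :
  0 < delta -> (hausdorff1_pre delta A <= hausdorff1 A)%E.
Proof. by move=> d0; apply: ereal_sup_ubound; exists delta. Qed.

Lemma hausdorff1_ge0 A : (0 <= hausdorff1 A)%E.
Proof.
exact: le_trans (hausdorff1_pre_ge0 1 A) (hausdorff1_pre_le A ltr01).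
Qed.

Lemma hausdorff1_set0 : hausdorff1 set0 = 0%E.
Proof.
apply/eqP; rewrite eq_le hausdorff1_ge0 andbT.
by apply: ge_ereal_sup => _ [d /= d0 <-]; rewrite hausdorff1_pre0.
Qed.

Lemma le_hausdorff1 : {homo hausdorff1 : A B / A `<=` B >-> (A <= B)%E}.
Proof.
move=> A B AB; apply: ge_ereal_sup => _ [d /= d0 <-].
exact: le_trans (le_hausdorff1_pre d AB) (hausdorff1_pre_le B d0).
Qed.

Lemma hausdorff1_sigma_subadditive : sigma_subadditive hausdorff1.
Proof.
move=> F; apply: ge_ereal_sup => _ [d /= d0 <-].
apply: le_trans (hausdorff1_pre_sigma_subadditive d F) _.
apply: lee_nneseries => [*|k _]; first exact: hausdorff1_pre_ge0.
exact: hausdorff1_pre_le.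
Qed.

HB.instance Definition _ := isOuterMeasure.Build R (R * R)%type hausdorff1
  hausdorff1_set0 hausdorff1_ge0 le_hausdorff1 hausdorff1_sigma_subadditive.

(* The plane with the sigma-algebra of the H^1-measurable sets (in the sense of
   Caratheodory), which contains the Borel sets. *)
Definition h1plane : Type :=
  caratheodory_type (hausdorff1 : {outer_measure set (R * R)%type -> \bar R}).
HB.instance Definition _ := Measurable.on h1plane.

Definition arclength : {measure set h1plane -> \bar R} :=
  (hausdorff1 : {outer_measure set (R * R)%type -> \bar R}) : set h1plane -> _.

Definition curve_length (S : set (R * R)) : R := fine (arclength S).

Definition average (S : set (R * R)) (g : R * R -> R) : R :=
  (\int[arclength]_(y in S) g y) / curve_length S.

Definition domain A := [/\ A !=set0, open A & connected A].

Definition C2_function (g : R -> R) :=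
  [/\ forall s, derivable g s 1, forall s, derivable (derive1 g) s 1 &
      continuous (derive1 (derive1 g))].

(* Near each boundary point, in coordinates (s, t) rotated by some angle, the set
   is the part t > g(s) lying on one side of the graph of a C^2 function. *)
Definition C2_boundary A :=
  forall p, frontier A p ->
  exists (alpha r : R) (g : R -> R), [/\ 0 < r, C2_function g &
    forall q, enorm (q - p) < r ->
      (A q <-> g (q.1 * cos alpha + q.2 * sin alpha) <
               - q.1 * sin alpha + q.2 * cos alpha)].

(* "Centered at the origin" is used both for a domain that contains the origin
   and for one whose centre of mass is the origin (an annulus, say); either is
   allowed. *)
Definition centered_at_origin A :=
  A (0, 0) \/
  let area := (@lebesgue_measure R \x @lebesgue_measure R)%E in
  \int[area]_(p in A) p.1 = 0 /\ \int[area]_(p in A) p.2 = 0.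

Definition inclusion (x : R * R) (eps : R) B : set (R * R) :=
  [set x + eps *: b | b in B].

Definition partial1 (v : R * R -> R) : R * R -> R := fun p => 'D_(1, 0) v p.
Definition partial2 (v : R * R -> R) : R * R -> R := fun p => 'D_(0, 1) v p.

Definition C1_on A (v : R * R -> R) :=
  forall p, A p ->
  [/\ derivable v p (1, 0), derivable v p (0, 1),
      {for p, continuous (partial1 v)} & {for p, continuous (partial2 v)}].

Definition C2_on A (v : R * R -> R) :=
  [/\ C1_on A v, C1_on A (partial1 v) & C1_on A (partial2 v)].

Definition harmonic_on A (v : R * R -> R) :=
  C2_on A v /\
  forall p, A p -> partial1 (partial1 v) p + partial2 (partial2 v) p = 0.

(* [u] is the harmonic function in the unit disk with boundary value [f], where
   [f theta] is the value at the boundary point of polar angle [theta]. *)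
Definition harmonic_extension (f : R -> R[i]) (u : R * R -> R[i]) :=
  [/\ harmonic_on unit_disk (fun p => complex.Re (u p)) /\
      harmonic_on unit_disk (fun p => complex.Im (u p)),
      {within closed_unit_disk, continuous (fun p => complex.Re (u p))} /\
      {within closed_unit_disk, continuous (fun p => complex.Im (u p))} &
      forall theta, u (cos theta, sin theta) = f theta].

(* e^(i n theta) *)
Definition fourier_mode (n : nat) (theta : R) : R[i] :=
  cos (n%:R * theta) +i* sin (n%:R * theta).

(* The factor [eps ^+ (2 - 1)] is eps^(d-1) in dimension d = 2. *)
Definition response_matrix (N J : nat) (eps : R) (x : 'I_J -> R * R)
    (B : 'I_J -> set (R * R)) (gamma : R * R -> R) (u0 : nat -> R * R -> R[i]) :
    'M[R[i]]_(N.+1) :=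
  \matrix_(n, m) ((eps ^+ (2 - 1))%:C *
    \sum_j (curve_length (frontier (B j)) *
            average (frontier (inclusion (x j) eps (B j))) gamma)%:C *
           u0 m (x j) * u0 n (x j)).

Definition test_vector (N : nat) (u0 : nat -> R * R -> R[i]) (x : R * R) :
    'cV[R[i]]_(N.+1) :=
  \col_n u0 n x.

End plane.

Arguments h1plane R : clear implicits.

(* Main.v *)
(* On the disk u0(., f_n) is z^n, by the weak maximum principle for the Dirichlet
   problem.  With z_j the complex coordinate of x_j, this gives F = Phi C Phi^T,
   where Phi is the Vandermonde matrix (z_j^n) and C is diagonal.  The entries of
   C are positive: the frontier of a bounded open set has positive length
   because it projects onto an interval, and it has finite length because near
   each point it is the graph of a Lipschitz function.  As J < N + 1, Phi has
   full column rank, so the range of F F^* is the span of the columns of Phi.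
   The vector phi_y lies in it only if y is some x_j, since the polynomial with
   simple roots z_1, ..., z_J has degree at most N and kills the span. *)
Require Import Defs.
From HB Require Import structures.
From mathcomp Require Import all_boot all_order all_algebra.
From mathcomp Require Import complex.
From mathcomp Require Import all_classical all_reals all_analysis.
From mathcomp Require Import measurable_realfun ring lra.
Set Implicit Arguments.
Unset Strict Implicit.
Unset Printing Implicit Defensive.
Import Order.TTheory GRing.Theory Num.Theory.
Import numFieldNormedType.Exports.
Local Open Scope classical_set_scope.
Local Open Scope ring_scope.
Local Open Scope complex_scope.
Local Open Scope sesquilinear_scope.

(** * Rank-one sums of Vandermonde vectors *)

Section vandermonde.
Context {C : numClosedFieldType}.

Lemma row_coef_mul_vander (N J : nat) (z : 'I_J -> C) (p : {poly C}) :
  (size p <= N.+1)%N ->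
  (\row_(n < N.+1) p`_n) *m (\matrix_(n, j) z j ^+ n) = \row_j p.[z j].
Proof.
move=> sp; apply/rowP => j; rewrite !mxE (horner_coef_wide _ sp).
by apply: eq_bigr => n _; rewrite !mxE.
Qed.

(** The rows of [L] hold the coefficients of the Lagrange interpolation polynomials of the nodes. *)
Lemma vander_left_inverse (N J : nat) (z : 'I_J -> C) :
  injective z -> (J <= N.+1)%N ->
  exists L : 'M[C]_(J, N.+1), L *m (\matrix_(n, j) z j ^+ n) = 1%:M.
Proof.
move=> zinj JN.
pose p k : {poly C} := \prod_(j <- rem k (enum 'I_J)) ('X - (z j)%:P).
have sp k : (size (p k) <= N.+1)%N.
  rewrite /p size_prod_XsubC size_rem ?mem_enum // size_enum_ord prednK //.
  exact: leq_ltn_trans (ltn_ord k).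
have pk k j : ((p k).[z j] == 0) = (j != k).
  rewrite /p horner_prod prodf_seq_eq0; apply/hasP/idP => [[l]|jk].
    rewrite mem_rem_uniq ?enum_uniq // inE mem_enum andbT => lk.
    by rewrite hornerXsubC subr_eq0 => /eqP/zinj ->.
  exists j; last by rewrite hornerXsubC subrr eqxx.
  by rewrite mem_rem_uniq ?enum_uniq // inE mem_enum jk.
exists (\matrix_k ((p k).[z k]^-1 *: \row_(n < N.+1) (p k)`_n)).
apply/row_matrixP => k; rewrite row_mul rowK -scalemxAl row_coef_mul_vander //.
apply/rowP => j; rewrite !mxE; case: eqVneq => [<-|kj].
  by rewrite mulVf // pk negbK.
by rewrite mulr0n; apply/eqP; rewrite mulf_eq0 pk (eq_sym j) kj orbT.
Qed.

(** If v A A^* = 0, then v A A^* v^*, the squared Hermitian norm of v A, is zero; hence v A = 0, and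
    v = 0 by row freeness. *)
Lemma gram_unitmx (m n : nat) (A : 'M[C]_(m, n)) :
  row_free A -> A *m A^t* \in unitmx.
Proof.
move=> Afree; rewrite -row_free_unit; apply: inj_row_free => v.
rewrite mulmxA => vAA; apply/eqP; rewrite -(mulmx_free_eq0 _ Afree).
apply: contraT => /dotmx_is_dotmx; rewrite dotmxE.
by rewrite trmx_mul map_mxM mulmxA vAA mul0mx mxE ltxx.
Qed.

(* [F = Phi c Phi^T] with [Phi] of full column rank, so that [F F^*] factors as
   [Phi] followed by a surjection onto the coefficient space. *)
Lemma range_vander_mx (N J : nat) (z c : 'I_J -> C) (y : C)
    (F := \matrix_(n < N.+1, m < N.+1) \sum_j c j * z j ^+ m * z j ^+ n) :
  injective z -> (forall j, c j != 0) -> (J < N.+1)%N ->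
  (exists w : 'cV[C]_N.+1, F *m F^t* *m w = \col_n y ^+ n) <->
  (exists j, z j = y).
Proof.
move=> zinj c0 JN.
pose Phi : 'M[C]_(N.+1, J) := \matrix_(n, j) z j ^+ n.
pose D : 'M[C]_J := diag_mx (\row_j c j).
have FE : F = Phi *m D *m Phi^T.
  apply/matrixP => n m; rewrite mul_mx_diag !mxE; apply: eq_bigr => j _.
  by rewrite !mxE mulrAC (mulrC (c j)).
have FFE : F *m F^t* = Phi *m (D *m (Phi^T *m (Phi^T)^t*) *m D^t* *m Phi^t*).
  by rewrite {1}FE FE !trmx_mul !map_mxM !mulmxA.
split=> [[w]|[k <-]].
  rewrite FFE -mulmxA; set a := (X in Phi *m X) => Phia.
  apply: contrapT => /forallNP zy.
  (* The J + 1 coefficients fit into N + 1 places because J < N + 1. As a row they annihilate the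
     columns of [Phi], but not the vector of powers of [y]. *)
  pose p : {poly C} := \prod_(j <- enum 'I_J) ('X - (z j)%:P).
  have sp : (size p <= N.+1)%N by rewrite /p size_prod_XsubC size_enum_ord.
  have pz j : p.[z j] = 0.
    apply/eqP; rewrite /p horner_prod prodf_seq_eq0; apply/hasP.
    by exists j; rewrite ?mem_enum // hornerXsubC subrr eqxx.
  have py : p.[y] != 0.
    rewrite /p horner_prod prodf_seq_neq0; apply/allP => j _ /=.
    by rewrite hornerXsubC subr_eq0; apply/eqP => yz; apply: (zy j).
  have : (\row_(n < N.+1) p`_n) *m (\col_n y ^+ n) = \row_(_ < 1) p.[y].
    rewrite -(@row_coef_mul_vander N 1 (fun=> y) p sp); congr mulmx;
    by apply/matrixP => n m; rewrite !mxE.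
  rewrite -Phia mulmxA row_coef_mul_vander // => /rowP/(_ 0).
  rewrite !mxE big1 => [|j _]; last by rewrite mxE pz mul0r.
  by move=> /esym/eqP; rewrite (negbTE py).
have [L LPhi] := @vander_left_inverse N J z zinj (ltnW JN).
have uD : D \in unitmx.
  by rewrite unitmxE det_diag unitfE; apply/prodf_neq0 => j _; rewrite mxE.
have uDC : D^t* \in unitmx by rewrite map_unitmx unitmx_tr.
set M := Phi^T *m _ in FFE.
have uM : M \in unitmx.
  apply: gram_unitmx; apply/row_freeP; exists L^T.
  by rewrite -trmx_mul LPhi trmx1.
have PhiL : Phi^t* *m L^t* = 1%:M by rewrite -map_mxM -trmx_mul LPhi trmx1 map_mx1.
(* The witness undoes the factors of F F^* from the right: Phi^* has the right inverse L^*, and D^*,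
   [M], [D] are invertible. What remains is column [k] of [Phi]. *)
exists (L^t* *m (invmx (D^t*) *m (invmx M *m (invmx D *m delta_mx k (0 : 'I_1))))).
rewrite FFE -!mulmxA (mulmxA (Phi^t*)) PhiL mul1mx (mulKVmx uDC).
rewrite (mulmxA Phi^T) -/M (mulKVmx uM) (mulKVmx uD).
by rewrite -colE; apply/colP => n; rewrite !mxE.
Qed.

End vandermonde.

Section plane.
Context {R : realType}.
Implicit Types (p q : R * R) (A B S : set (R * R)).

(** * One-dimensional Hausdorff measure *)

Lemma norm_le_enorm p : `|p| <= enorm p.
Proof.
rewrite prod_normE /enorm ge_max -!sqrtr_sqr !ler_wsqrtr//.
  by rewrite lerDr sqr_ge0.
by rewrite lerDl sqr_ge0.
Qed.

Lemma le_enorm_diam A p q : A p -> A q -> ((enorm (p - q))%:E <= diam A)%E.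
Proof.
by move=> Ap Aq; apply: ereal_sup_ubound; right; exists (p, q).
Qed.

Lemma diam_le A (r : R) : 0 <= r ->
  (forall p q, A p -> A q -> enorm (p - q) <= r) -> (diam A <= r%:E)%E.
Proof.
move=> r0 Ar; apply: ge_ereal_sup => _ [->|[[p q] [/= Ap Aq] <-]].
  by rewrite lee_fin.
by rewrite lee_fin Ar.
Qed.

Lemma hausdorff1_pre_antimono A (d e : R) :
  d <= e -> (hausdorff1_pre e A <= hausdorff1_pre d A)%E.
Proof.
move=> de; apply/ereal_inf_le_tmp => _ [U [dU AU] <-]; exists U => //.
by split=> // i; apply: le_trans (dU i) _; rewrite lee_fin.
Qed.

(** A set of diameter at most [d] cannot meet both [A] and [B], so every cover of the union contains
    disjoint subfamilies covering [A] and [B]. *)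
Lemma hausdorff1_pre_separatedU A B (d : R) :
  (forall p q, A p -> B q -> d < `|p - q|) ->
  (hausdorff1_pre d A + hausdorff1_pre d B <= hausdorff1_pre d (A `|` B))%E.
Proof.
move=> AB; apply: le_ereal_inf_tmp => _ [U [dU ABU] <-].
pose V S i := if `[< U i `&` S !=set0 >] then U i else set0.
have preV S : S `<=` A `|` B ->
    (hausdorff1_pre d S <= \sum_(i <oo) diam (V S i))%E.
  move=> SAB; apply: ereal_inf_lbound; exists (V S) => //; split=> [i|].
    rewrite /V; case: ifP => _; first exact: dU.
    by rewrite diam0 (le_trans (diam_ge0 _) (dU i)).
  move=> p Sp; have [i _ Uip] := ABU _ (SAB _ Sp).
  by exists i => //; rewrite /V asboolT //; exists p.
have := leeD (preV A (@subsetUl _ _ _)) (preV B (@subsetUr _ _ _)).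
move=> /le_trans; apply.
rewrite -nneseriesD; [|by move=> *; exact: diam_ge0..].
apply: lee_nneseries => [*|i _]; first by rewrite adde_ge0 ?diam_ge0.
rewrite /V; case: asboolP => [[p [Up Ap]]|_]; last first.
  by rewrite diam0 add0e; case: ifP => _ //; rewrite diam0 diam_ge0.
case: asboolP => [[q [Uq Bq]]|_]; last by rewrite diam0 adde0.
have := AB _ _ Ap Bq; rewrite ltNge => /negP[].
rewrite -lee_fin; apply: le_trans (dU i).
by apply: le_trans (le_enorm_diam Up Uq); rewrite lee_fin norm_le_enorm.
Qed.

Lemma hausdorff1_separatedU A B (d : R) : 0 < d ->
  (forall p q, A p -> B q -> d < `|p - q|) ->
  (hausdorff1 A + hausdorff1 B <= hausdorff1 (A `|` B))%E.
Proof.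
move=> d0 AB; set X := hausdorff1 (A `|` B).
have [->|Xoo] := eqVneq X +oo%E; first by rewrite leey.
have finX S : S `<=` A `|` B -> hausdorff1 S \is a fin_num.
  move=> SAB; rewrite ge0_fin_numE ?hausdorff1_ge0 //.
  by apply: le_lt_trans (le_hausdorff1 SAB) _; rewrite ltey.
have finA := finX _ (@subsetUl _ A B); have finB := finX _ (@subsetUr _ A B).
have fin_pre e S : 0 < e -> hausdorff1 S \is a fin_num ->
    hausdorff1_pre e S \is a fin_num.
  move=> e0; rewrite !ge0_fin_numE ?hausdorff1_ge0 ?hausdorff1_pre_ge0 //.
  by apply: le_lt_trans; exact: hausdorff1_pre_le.
rewrite -leeBrDr //; apply: ge_ereal_sup => _ [e /= e0 <-].
rewrite leeBrDr // addeC -leeBrDr ?fin_pre //.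
apply: ge_ereal_sup => _ [f /= f0 <-]; rewrite leeBrDr ?fin_pre //.
(* Refining the scales [e] and [f] to a common one only increases the premeasures, and a scale of at
   most [d] makes them superadditive. *)
pose h := Num.min (Num.min e f) d.
have h0 : 0 < h by rewrite !lt_min e0 f0 d0.
apply: le_trans (hausdorff1_pre_le _ h0); rewrite addeC.
apply: le_trans (hausdorff1_pre_separatedU (d := h) _).
  by apply: leeD; apply: hausdorff1_pre_antimono; rewrite /h !ge_min lexx ?orbT.
by move=> p q Ap Bq; apply: le_lt_trans (AB _ _ Ap Bq); rewrite ge_min lexx orbT.
Qed.

(* The metric outer measure argument: [A n] is the part of the test set [X] at
   distance at least [1 / (n + 1)] from [C].  It is at positive distance from the
   layer [B n.+1], and this makes the measures of the layers summable. *)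
Lemma closed_measurable_h1plane (C : set (R * R)) :
  closed C -> measurable (C : set (h1plane R)).
Proof.
move=> closedC.
pose mu : {outer_measure set (R * R)%type -> \bar R} := hausdorff1.
apply: (@le_caratheodory_measurable _ _ mu) => X.
have [->|Xoo] := eqVneq (mu X) +oo%E; first by rewrite leey.
pose A n := [set p | X p /\ forall c, C c -> n.+1%:R^-1 <= `|p - c|].
pose B k := A k.+1 `\` A k.
have AX n : A n `<=` X by move=> p [].
have invS n : n.+2%:R^-1 < n.+1%:R^-1 :> R.
  by rewrite ltf_pV2 ?posrE ?ltr_nat.
have Asub n : A n `<=` A n.+1.
  by move=> p [Xp pC]; split=> // c /pC; apply: le_trans; exact: ltW.
(* Points of [X] outside [A n.+1] are closer than 1/(n+2) to [C], those of [A n] at least 1/(n+1)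
   away from it. *)
have sepAX n D : D `<=` X -> (forall q, D q -> ~ A n.+1 q) ->
    (mu (A n) + mu D <= mu (A n `|` D))%E.
  move=> DX DA; apply: (hausdorff1_separatedU (d := n.+1%:R^-1 - n.+2%:R^-1)).
    by rewrite subr_gt0.
  move=> p q [_ pC] Dq; have := DA _ Dq.
  move=> /not_andP[/(_ (DX _ Dq))//|/existsNP[c /not_implyP[Cc /negP]]].
  rewrite -ltNge => qc; have := pC _ Cc.
  have : `|p - c| <= `|p - q| + `|q - c|.
    by rewrite (le_trans _ (ler_normD _ _)) // addrA subrK.
  move: qc; set a := _^-1; set b := _^-1; set u := `|_|; set v := `|_|; set w := `|_|.
  lra.
have XCA n : (mu (X `&` C) + mu (A n) <= mu X)%E.
  rewrite addeC; apply: le_trans (sepAX _ (X `&` C) _ _) _.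
  - by move=> p [].
  - move=> q [Xq Cq] [_ /(_ _ Cq)]; rewrite subrr normr0.
    by rewrite leNgt invr_gt0 ltr0n.
  - by apply: le_outer_measure => p [/AX|[]].
(* Consecutive layers may touch, but [B n.+1] is separated from [A n]. Layers of equal parity
   therefore add up, whence the two terms of the bound. *)
have sumB n : (\sum_(k < n.+1) mu (B k) <= mu (A n) + mu (A n.+1))%E.
  elim: n => [|n IHn].
    rewrite big_ord1; apply: le_trans (leeDr _ (outer_measure_ge0 _ _)).
    by apply: le_outer_measure; exact: subDsetl.
  rewrite big_ord_recr /=; apply: (@le_trans _ _ (mu (A n.+1) + (mu (A n) + mu (B n.+1)))%E).
    by rewrite addeA (addeC (mu (A n.+1))) leeD2r.
  rewrite leeD2l //; apply: le_trans (sepAX _ _ _ _) _.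
  - by move=> p [/AX].
  - by move=> p [].
  - by apply: le_outer_measure => p [/Asub/Asub|[]].
have sumBoo : (\sum_(k <oo) mu (B k) < +oo)%E.
  apply: (@le_lt_trans _ _ (mu X + mu X)%E); last by rewrite lte_add_pinfty // ltey.
  apply: lime_le; first by apply: is_cvg_nneseries => *; exact: outer_measure_ge0.
  apply: nearW => -[|n]; first by rewrite big_geq // adde_ge0 ?outer_measure_ge0.
  rewrite big_mkord; apply: le_trans (sumB n) _.
  by apply: leeD; apply: le_outer_measure; exact: AX.
(* As [C] is closed, a point of [X] off [C] lies in some [A m]; the least such index decides between
   [A n] and a later layer. *)
have XCsub n : X `&` ~` C `<=` A n `|` \bigcup_(k in ~` `I_n) B k.
  move=> p [Xp Cp].
  have [m Am] : exists m, `[< A m p >].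
    have := closed_openC closedC; rewrite openE => /(_ _ Cp).
    move=> /nbhs_ballP[e /= e0 eC].
    have [m me] := ltr_add_invr e0.
    exists m; apply/asboolP; split=> // c Cc; rewrite leNgt; apply/negP => pc.
    apply: (eC c) Cc; rewrite -ball_normE /ball_ /=.
    by apply: lt_trans pc _; rewrite add0r in me.
  have exm : exists m, (fun n => `[< A n p >]) m by exists m.
  have [k /asboolP Ak kmin] := ex_minnP exm.
  have [kn|nk] := leqP k n.
    left; elim: n kn => [|n IHn]; first by rewrite leqn0 => /eqP <-.
    by rewrite leq_eqVlt => /predU1P[<-//|]; rewrite ltnS => /IHn /Asub.
  right; case: k => // k in Ak kmin nk *.
  exists k; first by rewrite /= ltnNge; apply/negP; rewrite negbK -ltnS.
  by split=> //; move/asboolP/kmin; rewrite ltnn.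
(* The series of layers converges, so for large [n] the set [A n] exhausts the part of [X] off [C]
   up to measure [e]. *)
apply/lee_addgt0Pr => e e0.
have /= tail := nneseries_tail_cvg sumBoo (fun k _ => outer_measure_ge0 mu _).
have /fine_cvgP[tfin /cvgrPdist_lt/(_ _ e0) tlt] := tail.
have [n _ /(_ n (leqnn n)) /= [tn_fin tn]] := filterI tfin tlt.
have {}tn : (\sum_(n <= k <oo) mu (B k) < e%:E)%E.
  rewrite -(fineK tn_fin) lte_fin; apply: le_lt_trans tn.
  by rewrite sub0r normrN ler_norm.
apply: (@le_trans _ _ (mu (X `&` C) + (mu (A n) + e%:E))%E); last first.
  by rewrite addeA leeD2r.
rewrite leeD2l //; apply: le_trans (le_outer_measure _ _ _ (XCsub n)) _.
apply: le_trans (outer_measureU2 _ _ _) _; rewrite leeD2l //.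
by apply: le_trans (ltW tn); exact: outer_measure_sigma_subadditive_tail.
Qed.

(** Mean value theorem with the maximum of |g'| over the segment; the second derivative makes g'
    continuous. *)
Lemma derivable_le_lipschitz (g : R -> R) (a b : R) :
  (forall s, derivable g s 1) -> (forall s, derivable (derive1 g) s 1) ->
  exists2 M, 0 <= M & forall s t, s \in `[a, b] -> t \in `[a, b] ->
    `|g s - g t| <= M * `|s - t|.
Proof.
move=> dg ddg.
have [ab|ba] := leP a b; last first.
  by exists 0 => // s t; rewrite in_itv /= => /andP[/le_trans h /h]; rewrite leNgt ba.
have contg' : continuous (fun s => `|derive1 g s|).
  move=> s; apply: continuous_comp; last exact: norm_continuous.
  by apply: differentiable_continuous; apply/derivable1_diffP.
have [c _ cmax] := EVT_max ab (continuous_subspaceT contg').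
exists `|derive1 g c| => //.
have le_case s t : s <= t -> s \in `[a, b] -> t \in `[a, b] ->
    `|g t - g s| <= `|derive1 g c| * `|t - s|.
  move=> st; rewrite !in_itv /= => /andP[as_ sb] /andP[at_ tb].
  have [||u] := @MVT_segment _ g (derive1 g) s t st.
  - by move=> x _; rewrite derive1E; apply: DeriveDef.
  - apply: continuous_subspaceT => x.
    by apply: differentiable_continuous; apply/derivable1_diffP.
  rewrite in_itv /= => /andP[su ut] ->; rewrite normrM ler_wpM2r //.
  by apply: cmax; rewrite in_itv /= (le_trans as_ su) (le_trans ut tb).
move=> s t sI tI; case: (leP s t) => st.
  by rewrite distrC (distrC s); exact: le_case.
by apply: le_case => //; exact: ltW.
Qed.

(** Equal subdivisions of the segment give covers of the image by arbitrarily small sets, whose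
    diameters always add up to at most K (b - a). *)
Lemma hausdorff1_lipschitz_segment (h : R -> R * R) (a b K : R) :
  0 <= K -> a <= b ->
  (forall s t, s \in `[a, b] -> t \in `[a, b] ->
     enorm (h s - h t) <= K * `|s - t|) ->
  (hausdorff1 (h @` [set` `[a, b]]) <= (K * (b - a))%:E)%E.
Proof.
move=> K0 ab hK; apply: ge_ereal_sup => _ [d /= d0 <-].
have [n nd] : exists n, K * (b - a) / n.+1%:R <= d.
  exists (Num.truncn (K * (b - a) / d)); rewrite ler_pdivrMr ?ltr0n // ltW //.
  by rewrite (mulrC d) -ltr_pdivrMr // truncnS_gt.
pose l := (b - a) / n.+1%:R.
have n0 : 0 < n.+1%:R :> R by rewrite ltr0n.
have l0 : 0 <= l by rewrite divr_ge0 ?subr_ge0 // ltW.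
have nl : b = a + n.+1%:R * l by rewrite /l mulrC divfK ?gt_eqF // addrC subrK.
pose U i := if (i < n.+1)%N then
  h @` [set` `[a + i%:R * l, a + i.+1%:R * l]] else set0.
have diamU i : (i < n.+1)%N -> (diam (U i) <= (K * l)%:E)%E.
  move=> ilt; rewrite /U ilt; apply: diam_le; first exact: mulr_ge0.
  have sub s : s \in `[a + i%:R * l, a + i.+1%:R * l] -> s \in `[a, b].
    rewrite /= !in_itv /= => /andP[s1 s2]; apply/andP; split.
      by rewrite (le_trans _ s1) // lerDl mulr_ge0.
    by rewrite (le_trans s2) // nl lerD2l ler_wpM2r // ler_nat.
  move=> _ _ [s sI <-] [t tI <-]; apply: le_trans (hK _ _ (sub _ sI) (sub _ tI)) _.
  rewrite ler_wpM2l //; move: sI tI; rewrite /= !in_itv /= -natr1 mulrDl mul1r.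
  by rewrite ler_norml => /andP[? ?] /andP[? ?]; apply/andP; split; lra.
have Kl : K * l <= d by rewrite mulrA.
have diam_set0 i : (n.+1 <= i)%N -> diam (U i) = 0%E.
  by move=> ni; rewrite /U ltnNge ni diam0.
apply: (@le_trans _ _ (\sum_(i <oo) diam (U i))%E).
  apply: ereal_inf_lbound; exists U => //; split=> [i|_ [s /= sI <-]].
    case: (ltnP i n.+1) => ni; last by rewrite diam_set0 // lee_fin ltW.
    by apply: le_trans (diamU _ ni) _; rewrite lee_fin.
  move: sI; rewrite in_itv /= => /andP[as_ sb].
  have exm : exists m, s <= a + m.+1%:R * l by exists n; rewrite -nl.
  have [m sm mmin] := ex_minnP exm.
  have mn : (m < n.+1)%N by rewrite ltnS mmin // -nl.
  exists m => //; rewrite /U mn; exists s => //=; rewrite in_itv /= sm andbT.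
  case: m mmin {sm mn} => [|m] mmin; first by rewrite mul0r addr0.
  by rewrite leNgt; apply/negP => /ltW /mmin; rewrite ltnn.
rewrite (nneseries_split 0 n.+1); last by move=> *; exact: diam_ge0.
rewrite add0n [X in (_ + X)%E]eseries0 ?adde0; last by move=> i ni _; exact: diam_set0.
rewrite big_mkord; apply: (@le_trans _ _ (\sum_(i < n.+1) (K * l)%:E)%E).
  by apply: lee_sum => i _; exact: diamU.
rewrite sumEFin lee_fin sumr_const card_ord -mulr_natr -mulrA (mulrC l).
by rewrite [X in _ <= K * X](_ : _ = n.+1%:R * l) // nl addrC addKr.
Qed.

(** * Frontiers of C^2 domains *)

(* The sets whose complement in [S] has finite measure form a filter, which has
   no cluster point in [S]. *)
Lemma compact_hausdorff1_lty S : compact S ->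
  (forall q, S q -> exists2 U : set (R * R), open_nbhs q U &
     (hausdorff1 (S `&` U) < +oo)%E) ->
  (hausdorff1 S < +oo)%E.
Proof.
move=> cS locS; rewrite ltey; apply/eqP => Soo.
pose mu : {outer_measure set (R * R)%type -> \bar R} := hausdorff1.
pose F : set_system (R * R) := [set V | (mu (S `\` V) < +oo)%E].
have F_filter : Filter F.
  split=> [|P Q FP FQ|P Q PQ].
  - by rewrite /F /= setDT outer_measure0.
  - rewrite /F /= setDIr; apply: le_lt_trans (outer_measureU2 _ _ _) _.
    exact: lte_add_pinfty.
  - by apply: le_lt_trans; apply: le_outer_measure; exact: setDS.
have F_proper : ProperFilter F by split=> //; rewrite /F /= setD0 /mu /= Soo.
have [|q [Sq Fq]] := cS F F_proper; first by rewrite /F /= setDv outer_measure0.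
(* The complement of [U] belongs to the filter, so the cluster point would make [U] meet its own
   complement. *)
have [U qU SU] := locS q Sq.
have [|p [nUp Up]] := Fq (~` U) U _ (open_nbhs_nbhs qU); last exact: nUp.
by rewrite /F /= setDE setCK.
Qed.

Lemma bounded_closed_compact_plane S (M : R) :
  closed S -> (forall q, S q -> `|q| <= M) -> compact S.
Proof.
move=> cS SM.
apply: (@subclosed_compact _ _ ([set` `[- M, M]] `*` [set` `[- M, M]])) => //.
  by apply: compact_setX; exact: segment_compact.
move=> q /SM; rewrite prod_normE ge_max !ler_norml => /andP[q1 q2].
by split; rewrite /= in_itv.
Qed.

Lemma continuous_plane_linear (a b : R) :
  continuous (fun p : R * R => p.1 * a + p.2 * b).
Proof.
move=> p; apply: cvgD; apply: cvgM; try exact: cvg_cst.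
  exact: cvg_fst.
exact: cvg_snd.
Qed.

Lemma continuous_enorm : continuous (@enorm R).
Proof.
move=> p; apply: continuous_comp; last exact: sqrt_continuous.
apply: cvgD; rewrite expr2; apply: cvgM.
- exact: cvg_fst.
- exact: cvg_fst.
- exact: cvg_snd.
- exact: cvg_snd.
Qed.

Lemma frontier_open B : open B -> frontier B = closure B `\` B.
Proof. by move=> /interior_id oB; rewrite /frontier oB. Qed.

Lemma closed_frontier B : closed (frontier B).
Proof.
apply: closedI; first exact: closed_closure.
by apply: open_closedC; exact: open_interior.
Qed.

(** * Scaled copies of a domain and the finite length of their frontiers *)

Section incl.
Context (x : R * R) (eps : R) (eps0 : 0 < eps).

(** Inverse of the map b |-> x + eps b; it presents the scaled copy as a preimage under a continuous
    map. *)
Definition unincl q : R * R := eps^-1 *: (q - x).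

Lemma inclusionE B : inclusion x eps B = unincl @^-1` B.
Proof.
apply/seteqP; split=> [_ [b Bb <-]|q Bq].
  by rewrite /= /unincl (addrC x) addrK scalerA mulVf ?gt_eqF // scale1r.
by exists (unincl q) => //; rewrite /unincl scalerA divff ?gt_eqF // scale1r addrC subrK.
Qed.

Lemma continuous_unincl : continuous unincl.
Proof.
by move=> q; apply: cvgZr; apply: cvgB; [exact: cvg_id|exact: cvg_cst].
Qed.

Lemma open_inclusion B : open B -> open (inclusion x eps B).
Proof.
rewrite inclusionE; apply: open_comp => q _; exact: continuous_unincl.
Qed.

Lemma frontier_inclusion B q :
  frontier (inclusion x eps B) q -> frontier B (unincl q).
Proof.
rewrite inclusionE => -[cq iq]; split.
  by move=> V /continuous_unincl /cq [q' [Bq' Vq']]; exists (unincl q').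
by move=> /continuous_unincl.
Qed.

End incl.

(** A point above the graph is in the open set [B], which is disjoint from its frontier; a point
    below it has a neighbourhood outside [B], so it is not in the closure. *)
Lemma frontier_local_graph B p (alpha r : R) (g : R -> R) :
  open B -> continuous g ->
  (forall q, enorm (q - p) < r ->
     (B q <-> g (q.1 * cos alpha + q.2 * sin alpha) <
              - q.1 * sin alpha + q.2 * cos alpha)) ->
  forall q, frontier B q -> enorm (q - p) < r ->
    - q.1 * sin alpha + q.2 * cos alpha = g (q.1 * cos alpha + q.2 * sin alpha).
Proof.
move=> oB cg Bg q; rewrite frontier_open // => -[clBq nBq] qr.
pose s (q : R * R) := q.1 * cos alpha + q.2 * sin alpha.
pose t (q : R * R) := - q.1 * sin alpha + q.2 * cos alpha.
have cs : continuous s by exact: continuous_plane_linear.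
have ct : continuous t.
  rewrite (_ : t = fun q => q.1 * - sin alpha + q.2 * cos alpha).
    exact: continuous_plane_linear.
  by apply/funext => q'; rewrite /t mulrN mulNr.
apply/eqP; rewrite eq_le; apply/andP; split.
  by rewrite leNgt; apply/negP => /(Bg _ qr).2.
rewrite leNgt; apply/negP => tg.
have cgt : (fun q' => g (s q') - t q') @ q --> g (s q) - t q.
  apply: cvgB; last exact: ct.
  by apply: continuous_comp; [exact: cs|exact: cg].
have cball : (fun q' => enorm (q' - p)) @ q --> enorm (q - p).
  apply: continuous_comp; last exact: continuous_enorm.
  by apply: cvgB; [exact: cvg_id|exact: cvg_cst].
have near_below : \forall q' \near q, 0 < g (s q') - t q'.
  by apply: cvgr_gt cgt _ _; rewrite subr_gt0.
have near_ball : \forall q' \near q, enorm (q' - p) < r by apply: cvgr_lt cball _ _.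
have [q' [Bq' [q'g q'r]]] := clBq _ (filterI near_below near_ball).
by move: q'g; rewrite subr_gt0 => /ltW; rewrite leNgt => /negP; apply; apply/(Bg _ q'r).
Qed.

(** Cauchy-Schwarz for a unit vector: the deficit is the square of the other rotated coordinate. *)
Lemma rotation_coord_le (alpha : R) p : `|p.1 * cos alpha + p.2 * sin alpha| <= enorm p.
Proof.
rewrite /enorm -sqrtr_sqr ler_wsqrtr //.
rewrite -subr_ge0 [X in 0 <= X](_ : _ = (p.1 * sin alpha - p.2 * cos alpha) ^+ 2) ?sqr_ge0 //.
have := cos2Dsin2 alpha; set c := cos _; set s := sin _ => cs.
have -> : p.1 ^+ 2 + p.2 ^+ 2 = (p.1 ^+ 2 + p.2 ^+ 2) * (c ^+ 2 + s ^+ 2) by rewrite cs mulr1.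
ring.
Qed.

Lemma enorm_rotation (alpha u v : R) :
  enorm (u * cos alpha - v * sin alpha, u * sin alpha + v * cos alpha) =
  enorm (u, v).
Proof.
rewrite /enorm /=; congr Num.sqrt.
have := cos2Dsin2 alpha; set c := cos _; set s := sin _ => cs.
rewrite -[RHS]mulr1 -cs; ring.
Qed.

Lemma enorm_le_add (u v : R) : enorm (u, v) <= `|u| + `|v|.
Proof.
rewrite /enorm /= -(@ger0_norm _ (`|u| + `|v|)) ?addr_ge0 // -sqrtr_sqr.
apply: ler_wsqrtr; rewrite sqrrD !real_normK ?num_real // -addrA lerD2l lerDr.
by rewrite mulrn_wge0 // mulr_ge0.
Qed.

Lemma enormZ (a : R) p : enorm (a *: p) = `|a| * enorm p.
Proof.
rewrite /enorm /= !exprMn -mulrDr sqrtrM ?sqr_ge0 // sqrtr_sqr //.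
Qed.

(** By compactness it is enough to bound the length near each frontier point, where the frontier
    lies on a scaled and rotated Lipschitz graph. *)
Lemma hausdorff1_frontier_inclusion_lty (x : R * R) (eps M : R) B :
  0 < eps -> open B -> C2_boundary B ->
  (forall q, inclusion x eps B q -> `|q| <= M) ->
  (hausdorff1 (frontier (inclusion x eps B)) < +oo)%E.
Proof.
move=> eps0 oB C2B BM; apply: compact_hausdorff1_lty.
  apply: (bounded_closed_compact_plane (M := M)); first exact: closed_frontier.
  move=> q [clq _]; rewrite leNgt; apply/negP => Mq.
  have : \forall q' \near q, M < `|q'| by apply: cvgr_gt (@norm_continuous _ _ q) _ _.
  by move=> /clq[q' [/BM q'M /lt_le_trans/(_ q'M)]]; rewrite ltxx.
move=> q fq; set f := unincl x eps.
have [alpha [r [g [r0 [dg ddg _] Bg]]]] := C2B _ (frontier_inclusion eps0 fq).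
have cg : continuous g by move=> s; apply: differentiable_continuous; apply/derivable1_diffP.
exists [set q' | enorm (f q' - f q) < r].
  split; last by rewrite /= subrr /enorm /= expr0n addr0 sqrtr0.
  apply: (@open_comp _ _ (fun q' => enorm (f q' - f q)) [set z | z < r]); last exact: open_lt.
  move=> q' _; apply: continuous_comp; last exact: continuous_enorm.
  by apply: cvgB; [exact: continuous_unincl|exact: cvg_cst].
pose s0 := (f q).1 * cos alpha + (f q).2 * sin alpha.
(* [h] rotates the graph point (s, g s) back to the standard axes, then applies b |-> x + eps b. *)
pose h s := x + eps *: (s * cos alpha - g s * sin alpha, s * sin alpha + g s * cos alpha).
have [K K0 gK] := derivable_le_lipschitz (s0 - r) (s0 + r) dg ddg.
have ab : s0 - r <= s0 + r by rewrite lerD2l; lra.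
(* The Lipschitz constant is the scale [eps] times 1 + K, from the bound |s - t| + |g s - g t|. *)
have hK : (hausdorff1 (h @` [set` `[s0 - r, s0 + r]%R]) <=
    (eps * (1 + K) * (s0 + r - (s0 - r)))%:E)%E.
  apply: hausdorff1_lipschitz_segment => //; first by rewrite mulr_ge0 ?addr_ge0 // ltW.
  move=> s t sI tI; rewrite /h.
  rewrite [X in enorm X](_ : _ = eps *:
      ((s - t) * cos alpha - (g s - g t) * sin alpha,
       (s - t) * sin alpha + (g s - g t) * cos alpha)).
    rewrite enormZ enorm_rotation gtr0_norm // -mulrA ler_wpM2l ?(ltW eps0) //.
    by apply: le_trans (enorm_le_add _ _) _; rewrite mulrDl mul1r lerD2l gK.
  by rewrite opprD addrACA subrr add0r -scalerBr; congr (_ *: _); congr pair; rewrite /=; ring.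
apply: le_lt_trans (le_hausdorff1 _) (le_lt_trans hK (ltry _)).
move=> q' [/(frontier_inclusion eps0)-/[swap] /= q'r].
rewrite -/(f q') => fq'.
have e := frontier_local_graph oB cg Bg fq' q'r.
(* The parameter is the rotated abscissa of [f q']; it stays within [r] of [s0] since a rotated
   coordinate never exceeds the Euclidean norm. *)
exists ((f q').1 * cos alpha + (f q').2 * sin alpha).
  have := rotation_coord_le alpha (f q' - f q).
  rewrite /= in_itv /= !mulrBl addrACA -opprD -/s0 => /le_lt_trans/(_ q'r).
  by rewrite ltr_norml => /andP[? ?]; apply/andP; split; lra.
rewrite /h -e; have := cos2Dsin2 alpha; set c := cos _; set s := sin _ => cs.
rewrite [X in eps *: X](_ : _ = f q').
  by rewrite /f /unincl scalerA divff ?gt_eqF // scale1r addrC subrK.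
rewrite [RHS]surjective_pairing -[X in _ = (X, _)]mulr1 -[X in _ = (_, X)]mulr1 -cs.
by congr pair; ring.
Qed.

(** * Positive length of frontiers *)

(** A covering set of diameter d projects into an interval of length 2 d centred at the projection
    of one of its points. This crude choice costs the factor 2. *)
Lemma hausdorff1_ge_projection S (a b : R) :
  `]a, b[%classic `<=` fst @` S -> ((b - a)%:E <= hausdorff1 S + hausdorff1 S)%E.
Proof.
move=> abS; have [ba|ab] := leP b a.
  by apply: (@le_trans _ _ 0%E); rewrite ?adde_ge0 ?hausdorff1_ge0 // lee_fin subr_le0.
suff pre : ((b - a)%:E <= 2%:E * hausdorff1_pre 1 S)%E.
  rewrite -mule2n -mule_natl; apply: le_trans pre _.
  by rewrite lee_pmul2l // hausdorff1_pre_le.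
rewrite -lee_pdivrMl // -EFinM; apply: le_ereal_inf_tmp => _ [U [dU SU] <-].
rewrite EFinM lee_pdivrMl //.
have [u Uu] : {u : nat -> R * R & forall i, U i !=set0 -> U i (u i)}.
  apply: (@choice _ _ (fun i p => U i !=set0 -> U i p)) => i.
  have [[p Up]|nU] := pselect (U i !=set0); first by exists p.
  (* A default for empty covering sets, which cover no point of [S]. *)
  by exists (0, 0).
have dE i : diam (U i) = (fine (diam (U i)))%:E.
  rewrite fineK // ge0_fin_numE ?diam_ge0 //.
  exact: le_lt_trans (dU i) (ltry _).
pose d i := fine (diam (U i)).
have d0 i : 0 <= d i by rewrite fine_ge0 // diam_ge0.
pose I i := `[(u i).1 - d i, (u i).1 + d i]%classic : set R.
have abI : `]a, b[%classic `<=` \bigcup_i I i.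
  move=> s /abS[p Sp <-]; have [i _ Uip] := SU _ Sp; exists i => //.
  have Uiu : U i (u i) by apply: Uu; exists p.
  have := le_enorm_diam Uip Uiu; rewrite dE lee_fin -/(d i).
  move=> /(le_trans (norm_le_enorm _)).
  rewrite prod_normE ge_max => /andP[+ _]; rewrite ler_norml /I /= in_itv /=.
  by move=> /andP[? ?]; apply/andP; split; lra.
rewrite -nneseriesZl; last by move=> *; exact: diam_ge0.
have mI i : measurable (I i) by exact: measurable_itv.
have := @measure_sigma_subadditive _ _ _ (@lebesgue_measure R) _ I mI (measurable_itv _) abI.
rewrite /= lebesgue_measure_itv /= lte_fin ab -EFinD => /le_trans; apply.
apply: lee_nneseries => // i _.
rewrite /I lebesgue_measure_itv /= dE -/(d i) lte_fin; case: ifPn => _.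
  by rewrite -EFinD -EFinM lee_fin; lra.
by rewrite -EFinM lee_fin mulr_ge0.
Qed.

(** Over each abscissa close to that of a point of [B], the vertical slice of [B] is nonempty and
    bounded, and its supremum gives a frontier point. The projection of the frontier thus contains
    an interval. *)
Lemma hausdorff1_frontier_gt0 B (M : R) :
  open B -> B !=set0 -> (forall q, B q -> `|q| <= M) ->
  (0 < hausdorff1 (frontier B))%E.
Proof.
move=> oB [p Bp] BM; rewrite lt_neqAle hausdorff1_ge0 andbT eq_sym; apply/eqP => H0.
have [e /= e0 eB] := (nbhs_ballP _ _).1 (open_nbhs_nbhs (conj oB Bp)).
have : `]p.1 - e, p.1 + e[%classic `<=` fst @` frontier B.
  move=> s; rewrite /= in_itv /= => /andP[s1 s2].
  pose T := [set t | B (s, t)].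
  have Tp : T p.2.
    apply: eB; split => /=; last exact: ballxx.
    by rewrite /ball /= ltr_norml; apply/andP; split; lra.
  have supT : has_sup T.
    split; first by exists p.2.
    exists M => t /BM; rewrite prod_normE ge_max => /andP[_ /=].
    exact: le_trans (ler_norm _).
  exists (s, sup T) => //; rewrite frontier_open //; split.
    move=> V /nbhs_ballP[r /= r0 rV].
    have [t Tt tr] := sup_adherent r0 supT.
    exists (s, t); split => //; apply: rV; split => /=; first exact: ballxx.
    rewrite /ball /= ger0_norm ?subr_ge0; last exact: sup_ubound (proj2 supT) _ Tt.
    by rewrite ltrBlDr -ltrBlDl.
  move=> Bs; have [r /= r0 rB] := (nbhs_ballP _ _).1 (open_nbhs_nbhs (conj oB Bs)).
  have : T (sup T + r / 2).
    apply: rB; split => /=; first exact: ballxx.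
    rewrite /ball /= opprD addrA subrr sub0r normrN gtr0_norm ?divr_gt0 //; lra.
  move=> /(sup_ubound (proj2 supT)); rewrite gerDl leNgt => /negP; apply.
  by rewrite divr_gt0.
move=> /hausdorff1_ge_projection; rewrite H0 adde0 lee_fin; lra.
Qed.

(** * Averages along a curve *)

Lemma curve_length_gt0 S : (0 < hausdorff1 S < +oo)%E -> 0 < curve_length S.
Proof. by move=> S0; exact: fine_gt0. Qed.

(** The integral lies between two constant multiples of the length. The upper bound matters for the
    sign too, since [fine] sends an infinite integral to 0. *)
Lemma average_gt0 S (gamma : R * R -> R) (gmin gmax : R) :
  closed S -> (0 < hausdorff1 S < +oo)%E -> 0 < gmin ->
  measurable_fun (S : set (h1plane R)) (gamma : h1plane R -> R) ->
  {ae @arclength R, forall y : h1plane R, S y -> gmin <= gamma y <= gmax} ->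
  0 < average S gamma.
Proof.
move=> closedS /andP[S0 Soo] gmin0 mgamma gamma_bnd.
have mS : measurable (S : set (h1plane R)) by exact: closed_measurable_h1plane.
have ming : gmin <= Num.max gmin gmax by rewrite le_max lexx.
pose m := Num.max gmin gmax.
(* Clamping turns the almost everywhere bounds into bounds at every point without changing the
   integral over [S]. *)
pose g y := Num.max gmin (Num.min (gamma y) m).
have mg : @measurable_fun _ _ (h1plane R) (\bar R) S (fun y => (g y)%:E).
  apply/measurable_EFinP; apply: measurable_maxr; first exact: measurable_cst.
  by apply: measurable_minr => //; exact: measurable_cst.
have gE : @ae_eq _ (h1plane R) R (@arclength R) (fun=> \bar R) S
    (fun y => (gamma y)%:E) (fun y => (g y)%:E).
  apply: filterS gamma_bnd => y /[apply] /andP[gy1 gy2] /=; congr EFin.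
  by rewrite /g min_l ?max_r // le_max gy2 orbT.
have g_ge y : gmin <= g y by rewrite /g le_max lexx.
have g_le y : g y <= m by rewrite /g ge_max ming ge_min lexx orbT.
rewrite /average divr_gt0 // ?curve_length_gt0 ?S0 //.
have intE : (\int[@arclength R]_(y in S) (gamma y)%:E =
             \int[@arclength R]_(y in S) (g y)%:E)%E.
  have mgE : measurable_fun (S : set (h1plane R)) (fun y : h1plane R => (gamma y)%:E).
    exact/measurable_EFinP.
  exact: (@ae_eq_integral _ (h1plane R) R (@arclength R) S _ _ mS mgE mg gE).
rewrite /Rintegral intE.
have lo : (gmin%:E * arclength S <= \int[@arclength R]_(y in S) (g y)%:E)%E.
  rewrite -integral_cst //; apply: ge0_le_integral => //.
  - by move=> y _; rewrite lee_fin ltW.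
  - by move=> y _; rewrite lee_fin.
have hi : (\int[@arclength R]_(y in S) (g y)%:E <= m%:E * arclength S)%E.
  rewrite -integral_cst //; apply: ge0_le_integral => //.
  - by move=> y _; rewrite lee_fin (le_trans _ (g_ge y)) ?ltW.
  - by move=> y _; rewrite lee_fin.
apply: fine_gt0; apply/andP; split.
  by apply: lt_le_trans lo; rewrite mule_gt0.
by apply: le_lt_trans hi _; rewrite lte_mul_pinfty // lee_fin (le_trans _ ming) ?ltW.
Qed.

(** * The Dirichlet problem in the unit disk *)

(** If c > 0, then [df], which vanishes at 0, is positive just to the right of it, and the mean
    value theorem makes [f] exceed [f 0] there. *)
Lemma second_derivative_at_max (f df : R -> R) (c e : R) : 0 < e ->
  (forall s : R, `|s| < e -> is_derive s 1 f (df s)) -> is_derive (0 : R) 1 df c ->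
  (forall s : R, `|s| < e -> f s <= f 0) -> c <= 0.
Proof.
move=> e0 fdf dfc fmax; rewrite leNgt; apply/negP => c0.
have df0 : df 0 = 0.
  have ne0 : - e < e by lra.
  have in_e s : s \in `]- e, e[ -> `|s| < e by rewrite in_itv /= ltr_norml.
  have : is_derive (0 : R) 1 f 0.
    apply: (derive1_at_max (ltW ne0)).
    - by move=> s /in_e /fdf[].
    - by rewrite in_itv /= oppr_lt0 e0.
    - by move=> s /in_e; exact: fmax.
  by have := fdf 0; rewrite normr0 => /(_ e0) [_ fd] [_]; rewrite fd.
have [cvdf dfE] := dfc.
have : (fun h : R => h^-1 *: ((df \o shift 0) (h *: 1) - df 0)) @ 0^' --> c by rewrite -dfE.
move=> cvc.
have : \forall h \near (0 : R), h != 0 -> 0 < h^-1 *: ((df \o shift 0) (h *: 1) - df 0).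
  exact: (@cvgr_gt _ _ _ _ _ _ cvc _ c0).
move=> /nbhs_ballP[d /= d0 dP].
pose s := Num.min e d / 2.
have m0 : 0 < Num.min e d by rewrite lt_min e0 d0.
have s0 : 0 < s by rewrite divr_gt0.
have sm : s < Num.min e d by rewrite ltr_pdivrMr // ltr_pMr // ltr1n.
have [se sd] : s < e /\ s < d by move: sm; rewrite lt_min => /andP.
have df_gt0 t : 0 < t -> t <= s -> 0 < df t.
  move=> t0 ts; have := dP t; rewrite /ball /= sub0r normrN gtr0_norm //.
  move=> /(_ (le_lt_trans ts sd) (lt0r_neq0 t0)).
  by rewrite /= df0 subr0 addr0 /GRing.scale /= mulr1 pmulr_rgt0 // invr_gt0.
have [||t tI] := @MVT R f df 0 s s0.
- move=> t; rewrite in_itv /= => /andP[t0 ts]; apply: fdf.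
  by rewrite gtr0_norm // (lt_trans ts).
- apply: derivable_within_continuous => t; rewrite in_itv /= => /andP[t0 ts].
  have [] := fdf t; last by [].
  by rewrite ger0_norm // (le_lt_trans ts).
move: tI; rewrite in_itv /= => /andP[t0 /ltW ts] ffs.
have := fmax s; rewrite gtr0_norm // => /(_ se); rewrite -subr_le0 ffs subr0.
by rewrite leNgt mulr_gt0 // df_gt0.
Qed.

Lemma is_derive_line (w : R * R -> R) (q v : R * R) (s d : R) :
  is_derive (q + s *: v) v w d -> is_derive s 1 (fun s => w (q + s *: v)) d.
Proof.
have E : (fun h : R => h^-1 *: (((fun s => w (q + s *: v)) \o shift s) (h *: 1) -
    w (q + s *: v))) =
  (fun h : R => h^-1 *: ((w \o shift (q + s *: v)) (h *: v) - w (q + s *: v))).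
  apply/funext => h /=; congr (_ *: (w _ - _)).
  by rewrite scalerDl addrCA /GRing.scale /= mulr1.
by move=> [dw wd]; split; rewrite /derivable /derive E.
Qed.

Lemma closed_closed_unit_disk : closed (@closed_unit_disk R).
Proof.
apply: (@preimage_closed _ _ (@enorm R) [set z | z <= 1]) => //.
by move=> q _; exact: continuous_enorm.
Qed.

Lemma unit_disk_le1 p : closed_unit_disk p -> `|p| <= 1.
Proof. by apply: le_trans; exact: norm_le_enorm. Qed.

Lemma unit_circle_polar p : enorm p = 1 -> exists theta, p = (cos theta, sin theta).
Proof.
move=> p1.
have e : p.1 ^+ 2 + p.2 ^+ 2 = 1.
  by rewrite -(sqr_sqrtr (addr_ge0 (sqr_ge0 p.1) (sqr_ge0 p.2))) -/(enorm p) p1 expr1n.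
have bp : -1 <= p.1 <= 1.
  rewrite -ler_norml -sqrtr_sqr -[leRHS]sqrtr1 ler_wsqrtr // -e lerDl sqr_ge0 //.
have c : cos (acos p.1) = p.1 by apply: acosK; rewrite in_itv.
have s : sin (acos p.1) = `|p.2| by rewrite sin_acos // -e addrC addKr sqrtr_sqr.
have [p2|p2] := leP 0 p.2.
  by exists (acos p.1); rewrite c s ger0_norm // -surjective_pairing.
exists (- acos p.1); rewrite cosN sinN c s ltr0_norm // opprK -surjective_pairing //.
Qed.

(** Adding d |p|^2 raises the Laplacian from 0 to 4 d > 0, so the perturbed function has no interior
    maximum. *)
Lemma weak_maximum_principle (w w1 w2 w11 w22 : R * R -> R) :
  {within @closed_unit_disk R, continuous w} ->
  (forall p, unit_disk p -> is_derive p (1, 0) w (w1 p)) ->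
  (forall p, unit_disk p -> is_derive p (0, 1) w (w2 p)) ->
  (forall p, unit_disk p -> is_derive p (1, 0) w1 (w11 p)) ->
  (forall p, unit_disk p -> is_derive p (0, 1) w2 (w22 p)) ->
  (forall p, unit_disk p -> w11 p + w22 p = 0) ->
  (forall p, enorm p = 1 -> w p <= 0) ->
  forall p, unit_disk p -> w p <= 0.
Proof.
move=> cw dw1 dw2 dw11 dw22 harm bnd p0 p0D; rewrite leNgt; apply/negP => wp0.
(* On the circle [W] is then at most d < w p0, while its maximum is at least [w p0]; the maximum is
   attained inside. *)
pose d := w p0 / 2.
have d0 : 0 < d by rewrite divr_gt0.
pose W q := w q + d * (q.1 ^+ 2 + q.2 ^+ 2).
have cW : {within @closed_unit_disk R, continuous W}.
  have cpoly : continuous (fun q : R * R => d * (q.1 ^+ 2 + q.2 ^+ 2)).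
    move=> q; apply: cvgM; first exact: cvg_cst.
    apply: cvgD; rewrite expr2; apply: cvgM.
    - exact: cvg_fst.
    - exact: cvg_fst.
    - exact: cvg_snd.
    - exact: cvg_snd.
  by move=> q; apply: cvgD; [exact: cw|exact: continuous_subspaceT cpoly q].
have p0cD : closed_unit_disk p0 by exact: ltW.
have cD : compact (@closed_unit_disk R).
  exact: bounded_closed_compact_plane closed_closed_unit_disk unit_disk_le1.
have [q + qmax] := compact_EVT_max (ex_intro _ _ p0cD) cD cW.
rewrite inE => qD.
have Wp0 : w p0 <= W q.
  apply: le_trans (qmax p0 _); last by rewrite inE.
  by rewrite lerDl mulr_ge0 ?(ltW d0) // addr_ge0 ?sqr_ge0.
have qint : unit_disk q.
  rewrite /unit_disk /= lt_neqAle; apply/andP; split; last exact: qD.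
  apply/eqP => q1; move: Wp0; rewrite /W.
  have -> : q.1 ^+ 2 + q.2 ^+ 2 = 1.
    by rewrite -(sqr_sqrtr (addr_ge0 (sqr_ge0 q.1) (sqr_ge0 q.2))) -/(enorm q) q1 expr1n.
  have := bnd q q1; rewrite mulr1 /d; lra.
(* Along the line through [q] in the unit direction [v], [W] has second derivative c + 2 d at its
   maximum. *)
have dir (v : R * R) (u : R * R -> R) c :
    (forall p, unit_disk p -> is_derive p v w (u p)) ->
    is_derive q v u c -> v.1 ^+ 2 + v.2 ^+ 2 = 1 -> c + 2 * d <= 0.
  move=> dwu duc v1.
  pose f s := W (q + s *: v).
  pose df s := u (q + s *: v) + 2 * d * (q.1 * v.1 + q.2 * v.2 + s).
  have [e e0 eD] : exists2 e, 0 < e & forall s, `|s| < e -> unit_disk (q + s *: v).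
    have : \forall s \near (0 : R), enorm (q + s *: v) < 1.
      have cl : (fun s => enorm (q + s *: v)) @ (0 : R) --> enorm (q + 0 *: v).
        apply: continuous_comp; last exact: continuous_enorm.
        by apply: cvgD; [exact: cvg_cst|apply: cvgZl; exact: cvg_id].
      by apply: cvgr_lt cl _ _; rewrite scale0r addr0.
    move=> /nbhs_ballP[e e0 eP]; exists e => // s se; apply: eP.
    by rewrite /ball /= sub0r normrN.
  pose a := q.1 ^+ 2 + q.2 ^+ 2; pose b := q.1 * v.1 + q.2 * v.2.
  apply: (@second_derivative_at_max f df _ e) => //.
  - move=> s se.
    have -> : f = (fun s => w (q + s *: v)) + d \*: (cst a + (2 * b) \*: id + id * id).
      apply/funext => t; transitivity (w (q + t *: v) + d * (a + 2 * b * t + t * t)).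
        have -> : t * t = t * t * (v.1 ^+ 2 + v.2 ^+ 2) by rewrite v1 mulr1.
        rewrite /f /W /a /b; congr (_ + _).
        rewrite /= /GRing.scale /=; ring.
      by [].
    have dw := is_derive_line (dwu _ (eD _ se)).
    have dp := is_deriveD (is_deriveD (is_derive_cst a s 1)
      (is_deriveZ (2 * b) (is_derive_id s 1)))
      (is_deriveM (is_derive_id s 1) (is_derive_id s 1)).
    apply: (is_derive_eq (is_deriveD dw (is_deriveZ d dp))).
    by rewrite /df /b /GRing.scale /=; ring.
  - have -> : df = (fun s => u (q + s *: v)) + (2 * d) \*: (cst b + id) by [].
    have du : is_derive (0 : R) 1 (fun s => u (q + s *: v)) c.
      by apply: is_derive_line; rewrite scale0r addr0.
    have dp := is_deriveD (is_derive_cst b (0 : R) 1) (is_derive_id (0 : R) 1).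
    apply: (is_derive_eq (is_deriveD du (is_deriveZ (2 * d) dp))).
    by rewrite /GRing.scale /=; ring.
  - move=> s se; rewrite /f scale0r addr0; apply: qmax; rewrite inE /closed_unit_disk /=.
    by apply: ltW; exact: eD.
have e1 := dir (1, 0) w1 _ dw1 (dw11 _ qint).
have e2 := dir (0, 1) w2 _ dw2 (dw22 _ qint).
move: (e1) (e2) (harm _ qint); rewrite /= expr1n expr0n addr0 add0r => /(_ erefl) + /(_ erefl).
lra.
Qed.

(** * Real and imaginary parts of z^n *)

Definition zplane p : R[i] := p.1 +i* p.2.
Definition re_pow n p : R := complex.Re (zplane p ^+ n).
Definition im_pow n p : R := complex.Im (zplane p ^+ n).

Lemma zplaneX n p : zplane p ^+ n = re_pow n p +i* im_pow n p.
Proof. by rewrite /re_pow /im_pow; case: (zplane p ^+ n). Qed.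

Lemma re_pow0 : re_pow 0 = cst 1.
Proof. by apply/funext => p; rewrite /re_pow expr0. Qed.

Lemma im_pow0 : im_pow 0 = cst 0.
Proof. by apply/funext => p; rewrite /im_pow expr0. Qed.

Lemma re_powS n : re_pow n.+1 = fst * re_pow n - snd * im_pow n.
Proof. by apply/funext => p; rewrite {1}/re_pow exprS zplaneX. Qed.

Lemma im_powS n : im_pow n.+1 = fst * im_pow n + snd * re_pow n.
Proof. by apply/funext => p; rewrite {1}/im_pow exprS zplaneX. Qed.

Lemma zplane_polarX n (theta : R) :
  zplane (cos theta, sin theta) ^+ n = fourier_mode n theta.
Proof.
elim: n => [|n IHn].
  by rewrite /fourier_mode expr0 mul0r cos0 sin0.
rewrite exprS IHn /fourier_mode -natr1 mulrDl mul1r cosD sinD.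
by apply/eqP; rewrite eq_complex /=; apply/andP; split; apply/eqP; ring.
Qed.

Lemma is_derive_fst p v : is_derive p v fst v.1.
Proof.
have E : (fun h : R => h^-1 *: ((fst \o shift p) (h *: v) - fst p)) @ 0^' --> v.1.
  apply: (@cvg_trans _ ((cst v.1 : R -> R) @ 0^')); last exact: cvg_cst.
  apply: near_eq_cvg; near=> h.
  rewrite /= addrK /GRing.scale /= mulrA mulVf ?mul1r //.
  by near: h; exact: nbhs_dnbhs_neq.
split; first by apply/cvg_ex; exists v.1.
exact: cvg_lim E.
Unshelve. all: by end_near. Qed.

Lemma is_derive_snd p v : is_derive p v snd v.2.
Proof.
have E : (fun h : R => h^-1 *: ((snd \o shift p) (h *: v) - snd p)) @ 0^' --> v.2.
  apply: (@cvg_trans _ ((cst v.2 : R -> R) @ 0^')); last exact: cvg_cst.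
  apply: near_eq_cvg; near=> h.
  rewrite /= addrK /GRing.scale /= mulrA mulVf ?mul1r //.
  by near: h; exact: nbhs_dnbhs_neq.
split; first by apply/cvg_ex; exists v.2.
exact: cvg_lim E.
Unshelve. all: by end_near. Qed.

(* d(z^n) = n z^(n-1) dz *)
Lemma is_derive_pow n p v :
  is_derive p v (re_pow n) (n%:R * (re_pow n.-1 p * v.1 - im_pow n.-1 p * v.2)) /\
  is_derive p v (im_pow n) (n%:R * (im_pow n.-1 p * v.1 + re_pow n.-1 p * v.2)).
Proof.
elim: n => [|n [IHr IHi]].
  by rewrite re_pow0 im_pow0 !mul0r; split; exact: is_derive_cst.
(* The recurrence with the truncated predecessor fails at n = 0; the factor n makes both sides
   vanish there. *)
have rn : n%:R * re_pow n p = n%:R * (p.1 * re_pow n.-1 p - p.2 * im_pow n.-1 p).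
  by case: n {IHr IHi} => [|n]; rewrite ?mul0r // re_powS.
have im : n%:R * im_pow n p = n%:R * (p.1 * im_pow n.-1 p + p.2 * re_pow n.-1 p).
  by case: n {IHr IHi rn} => [|n]; rewrite ?mul0r // im_powS.
have d1 := is_derive_fst p v; have d2 := is_derive_snd p v.
rewrite re_powS im_powS /= -natr1; split.
  apply: (is_derive_eq (is_deriveB (is_deriveM d1 IHr) (is_deriveM d2 IHi))).
  rewrite /GRing.scale /=.
  transitivity (n%:R * re_pow n p * v.1 - n%:R * im_pow n p * v.2 +
                (re_pow n p * v.1 - im_pow n p * v.2)); last by ring.
  by rewrite rn im; ring.
apply: (is_derive_eq (is_deriveD (is_deriveM d1 IHi) (is_deriveM d2 IHr))).
rewrite /GRing.scale /=.
transitivity (n%:R * im_pow n p * v.1 + n%:R * re_pow n p * v.2 +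
              (im_pow n p * v.1 + re_pow n p * v.2)); last by ring.
by rewrite rn im; ring.
Qed.

Lemma continuous_pow n : continuous (re_pow n) /\ continuous (im_pow n).
Proof.
elim: n => [|n [IHr IHi]].
  by rewrite re_pow0 im_pow0; split=> p; exact: cvg_cst.
rewrite re_powS im_powS; split=> p; [apply: cvgB|apply: cvgD]; apply: cvgM.
- exact: cvg_fst.
- exact: IHr.
- exact: cvg_snd.
- exact: IHi.
- exact: cvg_fst.
- exact: IHi.
- exact: cvg_snd.
- exact: IHr.
Qed.

(** * Uniqueness and identification of the background solutions *)

(** The weak maximum principle applies to both u - v and v - u, which vanish on the circle. *)
Lemma harmonic_on_unique (u v v1 v2 v11 v22 : R * R -> R) :
  harmonic_on unit_disk u ->
  (forall p, is_derive p (1, 0) v (v1 p)) ->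
  (forall p, is_derive p (0, 1) v (v2 p)) ->
  (forall p, is_derive p (1, 0) v1 (v11 p)) ->
  (forall p, is_derive p (0, 1) v2 (v22 p)) ->
  (forall p, v11 p + v22 p = 0) ->
  {within @closed_unit_disk R, continuous u} -> continuous v ->
  (forall p, enorm p = 1 -> u p = v p) ->
  forall p, unit_disk p -> u p = v p.
Proof.
move=> [[C1u C1u1 C1u2] Lu] dv1 dv2 dv11 dv22 Lv cu cv uv p pD.
have du1 q : unit_disk q -> is_derive q (1, 0) u (partial1 u q).
  by move=> /C1u[? _ _ _].
have du2 q : unit_disk q -> is_derive q (0, 1) u (partial2 u q).
  by move=> /C1u[_ ? _ _].
have du11 q : unit_disk q -> is_derive q (1, 0) (partial1 u) (partial1 (partial1 u) q).
  by move=> /C1u1[? _ _ _].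
have du22 q : unit_disk q -> is_derive q (0, 1) (partial2 u) (partial2 (partial2 u) q).
  by move=> /C1u2[_ ? _ _].
have cv' : {within @closed_unit_disk R, continuous v} by exact: continuous_subspaceT.
apply/eqP; rewrite eq_le -subr_le0 -[X in _ && X]subr_le0; apply/andP; split.
  apply: (@weak_maximum_principle (u - v) (partial1 u - v1) (partial2 u - v2)
    (partial1 (partial1 u) - v11) (partial2 (partial2 u) - v22)) pD => //.
  - by move=> q; apply: cvgB; [exact: cu|exact: cv'].
  - by move=> q /du1 ?; exact: is_deriveB.
  - by move=> q /du2 ?; exact: is_deriveB.
  - by move=> q /du11 ?; exact: is_deriveB.
  - by move=> q /du22 ?; exact: is_deriveB.
  - move=> q qD; rewrite -[LHS]/((partial1 (partial1 u) q - v11 q) +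
      (partial2 (partial2 u) q - v22 q)).
    by rewrite addrACA -opprD Lu // Lv subrr.
  - by move=> q /uv uq; rewrite /= -[leLHS]/(_ q - _ q) uq subrr.
apply: (@weak_maximum_principle (v - u) (v1 - partial1 u) (v2 - partial2 u)
  (v11 - partial1 (partial1 u)) (v22 - partial2 (partial2 u))) pD => //.
- by move=> q; apply: cvgB; [exact: cv'|exact: cu].
- by move=> q /du1 ?; exact: is_deriveB.
- by move=> q /du2 ?; exact: is_deriveB.
- by move=> q /du11 ?; exact: is_deriveB.
- by move=> q /du22 ?; exact: is_deriveB.
- move=> q qD; rewrite -[LHS]/((v11 q - partial1 (partial1 u) q) +
    (v22 q - partial2 (partial2 u) q)).
  by rewrite addrACA -opprD Lu // Lv subrr.
- by move=> q /uv uq; rewrite /= -[leLHS]/(_ q - _ q) uq subrr.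
Qed.

(** Uniqueness is applied to the real and imaginary parts separately. Differentiating z^n twice in
    the second direction brings out i^2 = -1, so the Laplacian vanishes. *)
Lemma harmonic_extension_fourier n (u : R * R -> R[i]) :
  harmonic_extension (fourier_mode n) u ->
  forall p, unit_disk p -> u p = zplane p ^+ n.
Proof.
move=> [[hre him] [cre cim] bnd] p pD.
have ubnd q : enorm q = 1 -> u q = zplane q ^+ n.
  by move=> /unit_circle_polar[theta ->]; rewrite bnd zplane_polarX.
have [cr ci] := continuous_pow n.
(* Truncated predecessors do no harm: [c1] is zero for n = 0 and [c2] for n = 1. *)
pose c1 : R := n%:R; pose c2 : R := n.-1%:R.
have uRe : complex.Re (u p) = re_pow n p.
  apply: (@harmonic_on_unique (fun q => complex.Re (u q)) (re_pow n)
    (c1 \*: re_pow n.-1) (- c1 \*: im_pow n.-1)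
    (c1 \*: (c2 \*: re_pow n.-2)) (- c1 \*: (c2 \*: re_pow n.-2))) pD => //.
  - move=> q; have [d _] := is_derive_pow n q (1, 0); apply: (is_derive_eq d).
    by rewrite /= /GRing.scale /c1 /=; ring.
  - move=> q; have [d _] := is_derive_pow n q (0, 1); apply: (is_derive_eq d).
    by rewrite /= /GRing.scale /c1 /=; ring.
  - move=> q; have [d _] := is_derive_pow n.-1 q (1, 0); apply: (is_derive_eq (is_deriveZ _ d)).
    by rewrite /= /GRing.scale /c1 /c2 /=; ring.
  - move=> q; have [_ d] := is_derive_pow n.-1 q (0, 1); apply: (is_derive_eq (is_deriveZ _ d)).
    by rewrite /= /GRing.scale /c1 /c2 /=; ring.
  - by move=> q; rewrite /= /GRing.scale /=; ring.
  - by move=> q /ubnd ->.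
have uIm : complex.Im (u p) = im_pow n p.
  apply: (@harmonic_on_unique (fun q => complex.Im (u q)) (im_pow n)
    (c1 \*: im_pow n.-1) (c1 \*: re_pow n.-1)
    (c1 \*: (c2 \*: im_pow n.-2)) (- c1 \*: (c2 \*: im_pow n.-2))) pD => //.
  - move=> q; have [_ d] := is_derive_pow n q (1, 0); apply: (is_derive_eq d).
    by rewrite /= /GRing.scale /c1 /=; ring.
  - move=> q; have [_ d] := is_derive_pow n q (0, 1); apply: (is_derive_eq d).
    by rewrite /= /GRing.scale /c1 /=; ring.
  - move=> q; have [_ d] := is_derive_pow n.-1 q (1, 0); apply: (is_derive_eq (is_deriveZ _ d)).
    by rewrite /= /GRing.scale /c1 /c2 /=; ring.
  - move=> q; have [d _] := is_derive_pow n.-1 q (0, 1); apply: (is_derive_eq (is_deriveZ _ d)).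
    by rewrite /= /GRing.scale /c1 /c2 /=; ring.
  - by move=> q; rewrite /= /GRing.scale /=; ring.
  - by move=> q /ubnd ->.
by rewrite zplaneX -uRe -uIm; case: (u p).
Qed.

End plane.

(** * Positive weights and the range of F F^* *)

Lemma zplane_inj (R : realType) : injective (@zplane R).
Proof. by move=> [a b] [c d] [-> ->]. Qed.

(** Transfers the bounds on [gamma] from the boundary of the union to that of each inclusion. A
    frontier point of [A i] inside an open [A k] would make [A k] meet [A i], which disjointness
    allows only for k = i. *)
Lemma frontier_sub_bigcup (R : realType) (I : Type) (A : I -> set (R * R)) (i : I) :
  trivIset setT A -> (forall i, open (A i)) ->
  frontier (A i) `<=` frontier (\bigcup_i A i).
Proof.
move=> tA oA p; rewrite !frontier_open //; last exact: bigcup_open.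
move=> [clp np]; split; first by apply: closure_subset clp; exact: bigcup_sup.
move=> [k _ Akp]; have [q [Aiq Akq]] := clp _ (open_nbhs_nbhs (conj (oA k) Akp)).
have ik : i = k by apply: tA => //; exists q.
by apply: np; rewrite ik.
Qed.

Unset Implicit Arguments.

Theorem theorem3p3 (R : realType) (N J : nat) (eps gamma_min gamma_max : R)
    (x : 'I_J -> R * R) (B : 'I_J -> set (R * R)) (gamma : R * R -> R)
    (u0 : nat -> R * R -> R[i])
    (D_ := fun j => inclusion (x j) eps (B j))
    (D := \bigcup_(j : 'I_J) D_ j)
    (F := response_matrix N eps x B gamma u0) :
  0 < eps ->
  injective x ->
  (forall j, unit_disk (x j)) ->
  (forall j, [/\ domain (B j), C2_boundary (B j) & centered_at_origin (B j)]) ->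
  trivIset setT D_ ->
  D `<=` unit_disk ->
  0 < gamma_min ->
  measurable_fun (frontier D : set (h1plane R)) (gamma : h1plane R -> R) ->
  {ae @arclength R, forall y : h1plane R,
     frontier D y -> gamma_min <= gamma y <= gamma_max} ->
  (forall n, (n <= N)%N -> harmonic_extension (fourier_mode n) (u0 n)) ->
  (J < N + 1)%N ->
  forall y, unit_disk y ->
    range (fun w : 'cV[R[i]]_(N.+1) => F *m F^t* *m w) (test_vector N u0 y)
    <-> range x y.
Proof.
move=> eps0 xinj xD domB tD DD gmin0 mgamma gamma_bnd u0E; rewrite addn1 => JN y yD.
have oB j : open (B j) by have [[]] := domB j.
have oD j : open (D_ j) by exact: open_inclusion.
have Dle1 j q : D_ j q -> `|q| <= 1.
  move=> Djq; apply: le_trans (norm_le_enorm _) _; apply: ltW.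
  by apply: DD; exists j.
have u0z n p : (n <= N)%N -> unit_disk p -> u0 n p = zplane p ^+ n.
  by move=> nN; exact: harmonic_extension_fourier (u0E n nN) p.
(* The weight involves two curves: the length is that of the frontier of [B j], the average runs
   over the frontier of [D_ j]. Both must have positive finite length. *)
pose c j : R := eps ^+ (2 - 1) *
  (curve_length (frontier (B j)) * average (frontier (D_ j)) gamma).
have c0 j : (c j)%:C != 0.
  rewrite fmorph_eq0 gt_eqF // mulr_gt0 ?exprn_gt0 // mulr_gt0 //.
    have [[nB _ _] C2B _] := domB j.
    (* Seen as its own copy with centre 0 and scale 1, [B j] falls under the finiteness result for
       inclusions; it is bounded because its scaled copy lies in the disk. *)
    have B1 : inclusion 0 1 (B j) = B j.
      rewrite inclusionE // /unincl; apply/seteqP.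
      by split=> q /=; rewrite subr0 invr1 scale1r.
    have Bbnd q : B j q -> `|q| <= eps^-1 * (1 + `|x j|).
      move=> Bq; have : D_ j (x j + eps *: q) by exists q.
      move=> /Dle1 qle; rewrite ler_pdivlMl //.
      rewrite -{1}(gtr0_norm eps0) -normrZ -(addKr (x j) (eps *: q)).
      by rewrite (le_trans (ler_normD _ _)) // normrN addrC lerD2r.
    apply: curve_length_gt0; apply/andP; split.
      exact: hausdorff1_frontier_gt0 nB Bbnd.
    rewrite -B1; apply: (hausdorff1_frontier_inclusion_lty (M := eps^-1 * (1 + `|x j|))) => //.
    by rewrite B1.
  have [[[b Bb] _ _] C2B _] := domB j.
  have Dfr : frontier (D_ j) `<=` frontier D by exact: frontier_sub_bigcup.
  apply: (@average_gt0 _ _ _ gamma_min gamma_max) => //.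
  - exact: closed_frontier.
  - apply/andP; split.
      by apply: hausdorff1_frontier_gt0 (@Dle1 j) => //; exists (x j + eps *: b); exists b.
    exact: hausdorff1_frontier_inclusion_lty (@Dle1 j).
  - apply: measurable_funS mgamma => //.
    by apply: closed_measurable_h1plane; exact: closed_frontier.
  - by apply: filterS gamma_bnd => p + /Dfr; apply.
have FE : F = \matrix_(n < N.+1, m < N.+1)
    \sum_j (c j)%:C * zplane (x j) ^+ m * zplane (x j) ^+ n.
  apply/matrixP => n m; rewrite !mxE mulr_sumr; apply: eq_bigr => j _.
  rewrite (u0z m) -1?ltnS // (u0z n) -1?ltnS // mulrA mulrA.
  by congr (_ * _ * _); rewrite -rmorphM.
have yE : test_vector N u0 y = \col_n zplane y ^+ n.
  by apply/colP => n; rewrite !mxE u0z // -ltnS.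
have zinj : injective (fun j => zplane (x j)) by move=> i j /zplane_inj /xinj.
have [rangeF Frange] := range_vander_mx (zplane y) zinj c0 JN.
rewrite FE yE; split=> [[w _ Fw]|[j _ xjy]].
  by have [|j /zplane_inj <-] := rangeF; [exists w|exists j].
by have [|w Fw] := Frange; [exists j; rewrite xjy|exists w].
Qed.
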